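(* Let $\{(T(l),v(l))\}_{l\ge 0}$, with $T(l)=\{t_{ij}(l)\}\in\mathbb{R}^{m\times n}$ and $v(l)\in\mathbb{R}^n$, be the sequence generated by the following algorithm (Algorithm 1). Initialize $T(0)=K$, $v(0)=\tilde v$, and iterate for $l=0,1,2,\dots$, for all $i=1,\dots,m$ and $j=1,\dots,n$: $$c_{1i}(l+1)=\frac{\tilde u_i}{\sum_{j=1}^n t_{ij}(l)},\qquad c_{2j}(l+1)=\left(\frac{v_j(l)}{\sum_{i=1}^m c_{1i}(l+1)\,t_{ij}(l)}\right)^{\frac{\gamma}{1+\gamma}},$$ $$t_{ij}(l+1)=c_{1i}(l+1)\,t_{ij}(l)\,c_{2j}(l+1),\qquad v_j(l+1)=c_{2j}(l+1)^{-1/\gamma}\,v_j(l).$$ Then this sequence converges to a (unique) limit $(T^*,v^* )$, and $T^*$ is the minimizer for the optimization problem $$\min_{T\in\mathcal V(\tilde u)}\; KL(T|K)+\gamma\, KL(v_T|\tilde v).$$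
   Context: Let $m,n$ be positive integers, and let $\tilde u\in\mathbb{R}^m$, $\tilde v\in\mathbb{R}^n$ have $\tilde u_i>0$ for all $i$ and $\tilde v_j>0$ for all $j$ (it is not assumed that $\sum_i\tilde u_i=\sum_j\tilde v_j$). Let $\mathcal Z\subseteq\{1,\dots,m\}\times\{1,\dots,n\}$ be a set of index pairs such that for every $i$ there is at least one $j$ with $(i,j)\notin\mathcal Z$, and for every $j$ there is at least one $i$ with $(i,j)\notin\mathcal Z$. Define $$\mathcal T=\{T\in\mathbb{R}^{m\times n}: t_{ij}\ge 0\ \forall (i,j)\notin\mathcal Z,\ t_{ij}=0\ \forall (i,j)\in\mathcal Z\},$$ $$\mathcal V(\tilde u)=\Big\{T\in\mathcal T:\ \sum_{j=1}^n t_{ij}=\tilde u_i,\ i=1,\dots,m\Big\}.$$ Let $\gamma>0$, $\gamma_0>0$, costs $c_{ij}\in\mathbb{R}$, and $\tilde T\in\mathcal T$ with $\tilde t_{ij}>0$ for all $(i,j)\notin\mathcal Z$ be given. Define $K=\{k_{ij}\}\in\mathbb{R}^{m\times n}$ by $k_{ij}=\tilde t_{ij}\exp(-c_{ij}/\gamma_0)$ if $(i,j)\notin\mathcal Z$ and $k_{ij}=0$ if $(i,j)\in\mathcal Z$ (so $k_{ij}>0$ exactly when $(i,j)\notin\mathcal Z$). For scalars $t\ge 0$, $s>0$, define $kl(t|s)=s$ if $t=0$, and $kl(t|s)=t\log(t/s)-t+s$ if $t>0$. Define $KL(T|K)=\sum_{(i,j)\notin\mathcal Z}kl(t_{ij}|k_{ij})$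 for $T\in\mathcal T$, and $KL(v|\tilde v)=\sum_{j=1}^n kl(v_j|\tilde v_j)$ for $v\in\mathbb{R}^n$ with $v_j\ge 0$. For $T\in\mathcal T$, $v_T\in\mathbb{R}^n$ denotes the vector of column sums, $v_{T_j}=\sum_{i=1}^m t_{ij}$. *)

(* Defs.v *)
From HB Require Import structures.
From mathcomp Require Import all_boot all_order all_algebra.
From mathcomp Require Import all_classical all_reals all_analysis.

Set Implicit Arguments.
Unset Strict Implicit.
Unset Printing Implicit Defensive.

Import Order.TTheory GRing.Theory Num.Theory.
Import numFieldNormedType.Exports.

Local Open Scope classical_set_scope.
Local Open Scope ring_scope.

Section UnbalancedTransport.
Context {R : realType} {m n : nat}.
Implicit Types (Z : {set 'I_m * 'I_n}) (T K c : 'M[R]_(m, n)).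
Implicit Types (u : 'rV[R]_m) (v : 'rV[R]_n).

Definition row_sum T (i : 'I_m) : R := \sum_(j < n) T i j.
Definition col_sums T : 'rV[R]_n := \row_(j < n) \sum_(i < m) T i j.

(* [Z] is the set of forbidden index pairs (structural zeros). *)
Definition plans Z : set 'M[R]_(m, n) :=
  [set T | (forall i j, (i, j) \notin Z -> 0 <= T i j) /\
           (forall i j, (i, j) \in Z -> T i j = 0)].

Definition row_plans Z u : set 'M[R]_(m, n) :=
  [set T | plans Z T /\ forall i, row_sum T i = u 0 i].

Definition ref_kernel Z (gamma0 : R) c T : 'M[R]_(m, n) :=
  \matrix_(i, j) if (i, j) \in Z then 0 else T i j * expR (- c i j / gamma0).

(* Only meaningful for [0 <= t] and [0 < s]. *)
Definition kl (t s : R) : R :=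
  if t == 0 then s else t * ln (t / s) - t + s.

Definition KL_plan Z T K : R :=
  \sum_(p | p \notin Z) kl (T p.1 p.2) (K p.1 p.2).

Definition KL_vec (v w : 'rV[R]_n) : R := \sum_(j < n) kl (v 0 j) (w 0 j).

Definition objective Z K v (gamma : R) T : R :=
  KL_plan Z T K + gamma * KL_vec (col_sums T) v.

Definition scaling_row u T (i : 'I_m) : R := u 0 i / row_sum T i.

Definition scaling_col u (gamma : R) T v (j : 'I_n) : R :=
  (v 0 j / \sum_(i < m) scaling_row u T i * T i j) `^ (gamma / (1 + gamma)).

Definition scaling_step u (gamma : R) (Tv : 'M[R]_(m, n) * 'rV[R]_n) :
    'M[R]_(m, n) * 'rV[R]_n :=
  let: (T, v) := Tv in
  (\matrix_(i, j) (scaling_row u T i * T i j * scaling_col u gamma T v j),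
   \row_j (scaling_col u gamma T v j `^ (- 1 / gamma) * v 0 j)).

Definition scaling_seq u (gamma : R) K v (l : nat) :
    'M[R]_(m, n) * 'rV[R]_n :=
  iter l (scaling_step u gamma) (K, v).

End UnbalancedTransport.

Definition minimizer {R : realType} {X : Type} (A : set X) (f : X -> R) (x : X) :
    Prop :=
  A x /\ forall y, A y -> f x <= f y.

(* Main.v *)
(** The iterates have the form [T(l) = diag(a) K diag(exp b(l))] and
    [v_j(l) = v_j exp(- b_j(l) / gamma)], where, in the coordinates [b], one
    iteration is a map [G] that is order preserving and satisfies
    [G (b + d) = G b + gamma / (1 + gamma) * d] for constants [d]. Hence [G] is a
    contraction of ratio [gamma / (1 + gamma)] for the sup norm, and [b(l)]
    converges to its fixed point whatever the zero pattern of [K].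

    At the fixed point the limit plan [S] satisfies [ln (S_ij / K_ij) = a_i + b_j]
    (with [a], [b] now logarithmic) and its column sums are
    [y_j = v_j exp(- b_j / gamma)]; the three-point identity of [kl] then gives,
    for every feasible [T] with column sums [w],
    [objective T = objective S + KL T S + gamma * KL w y]. *)

Require Import Defs.
From HB Require Import structures.
From mathcomp Require Import all_boot all_order all_algebra.
From mathcomp Require Import all_classical all_reals all_analysis.
From mathcomp Require Import ring lra.

Set Implicit Arguments.
Unset Strict Implicit.
Unset Printing Implicit Defensive.

Import Order.TTheory GRing.Theory Num.Theory.
Import numFieldNormedType.Exports.

Local Open Scope classical_set_scope.
Local Open Scope ring_scope.

(** * Matrix limits, the sup norm and Banach iteration *)

(** Makes row vectors a [completeNormedModType], the setting of [iter_contraction_cvg]. *)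
HB.instance Definition _ (R : realType) (m n : nat) :=
  Uniform_isComplete.Build 'M[R]_(m, n) cauchy_cvg.

Lemma cvg_mx (R : realType) (m n : nat) (F : nat -> 'M[R]_(m, n))
    (M : 'M[R]_(m, n)) :
  (forall i j, F l i j @[l --> \oo] --> M i j) -> F l @[l --> \oo] --> M.
Proof.
move=> FM; apply/cvg_ballP => e e0; near=> l.
split=> // i j; move: i j; near: l.
apply: filter_forall => i; apply: filter_forall => j.
by have /cvg_ballP /(_ e e0) := FM i j.
Unshelve. all: by end_near. Qed.

(** The bound [0 <= d] covers matrices without entries, whose norm is 0. *)
Lemma mx_norm_leP (R : realType) (m n : nat) (A : 'M[R]_(m, n)) (d : R) :
  0 <= d -> reflect (forall i j, `|A i j| <= d) (`|A| <= d).
Proof.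
move=> d0; rewrite {2}/Num.norm /= mx_normrE.
apply: (iffP idP) => [Ad i j|Ad]; last by apply: bigmax_le.
exact: le_trans (le_bigmax 0 (fun p => `|A p.1 p.2|) (i, j)) Ad.
Qed.

Lemma iter_contraction_cvg (R : realType) (X : completeNormedModType R)
    (f : X -> X) (q : R) (x0 : X) :
  0 <= q -> q < 1 -> (forall x y, `|f x - f y| <= q * `|x - y|) ->
  exists2 x, f x = x & iter l f x0 @[l --> \oo] --> x.
Proof.
move=> q0 q1 fq.
pose g : {fun [set: X] >-> [set: X]} := totalfun f.
have cg : contraction (NngNum q0) g by split=> // -[x y] _ /=; exact: fq.
exists (limn (fun l => iter l f x0)).
  exact/esym/(contraction_cvg_fixed cg (base := x0)).
exact: (contraction_cvg cg (base := x0)).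
Qed.

(** * The scalar divergence [kl] *)

Section KullbackLeibler.
Context {R : realType}.
Implicit Types r s t : R.

(** Bregman identity for the generator [t ln t - t]; the value [kl 0 s = s] extends it to
    [t = 0]. *)
Lemma kl_three_points t r s : 0 <= t -> 0 < r -> 0 < s ->
  kl t s = kl t r + kl r s + (t - r) * ln (r / s).
Proof.
move=> t0 r0 s0; rewrite /kl (gt_eqF r0).
have [->|tN0] := eqVneq t 0; first by ring.
have {tN0}t0 : 0 < t by rewrite lt_def tN0.
by rewrite !ln_div ?posrE//; ring.
Qed.

(** For [t > 0], this is the strict bound [1 + x < exp x] at [x = ln (s / t)], multiplied by [t]. *)
Lemma kl_gt0 t s : 0 <= t -> 0 < s -> t != s -> 0 < kl t s.
Proof.
move=> t0 s0 ts; rewrite /kl; have [//|tN0] := eqVneq t 0.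
have {tN0}t0 : 0 < t by rewrite lt_def tN0.
have st0 : 0 < s / t by rewrite divr_gt0.
have lnst : ln (s / t) != 0.
  rewrite -ln1; apply: contra ts => /eqP /ln_inj.
  by rewrite !posrE => /(_ st0 ltr01) /divr1_eq ->.
have := expR_gt1Dx lnst; rewrite lnK ?posrE// ltr_pdivlMr//.
by rewrite !ln_div ?posrE//; nra.
Qed.

Lemma kl_ge0 t s : 0 <= t -> 0 < s -> 0 <= kl t s.
Proof.
move=> t0 s0; have [->|ts] := eqVneq t s; last exact/ltW/kl_gt0.
by rewrite /kl gt_eqF// divff ?gt_eqF// ln1 mulr0 sub0r addNr.
Qed.

Lemma kl_eq0 t s : 0 <= t -> 0 < s -> kl t s = 0 -> t = s.
Proof.
move=> t0 s0 kl0; apply/eqP; apply: contraT => ts.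
by have := kl_gt0 t0 s0 ts; rewrite kl0 ltxx.
Qed.

End KullbackLeibler.

(** * The iteration in logarithmic coordinates *)

Section LogSweep.
Context {R : realType} {m n : nat}.
Variables (u : 'rV[R]_m) (v : 'rV[R]_n) (gamma : R) (K : 'M[R]_(m, n)).
Hypothesis u_gt0 : forall i, 0 < u 0 i.
Hypothesis v_gt0 : forall j, 0 < v 0 j.
Hypothesis gamma_gt0 : 0 < gamma.
Hypothesis K_ge0 : forall i j, 0 <= K i j.
Hypothesis K_row : forall i, exists j, 0 < K i j.
Hypothesis K_col : forall j, exists i, 0 < K i j.
Implicit Types (b : 'rV[R]_n) (i : 'I_m) (j : 'I_n).

Definition row_mass b i : R := \sum_(k < n) K i k * expR (b 0 k).

(** Column sum after the row step, divided by [exp b_j]. *)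
Definition col_mass b j : R := \sum_(i < m) u 0 i / row_mass b i * K i j.

Definition log_sweep b : 'rV[R]_n :=
  \row_j (gamma / (1 + gamma) * (ln (v 0 j) - ln (col_mass b j))).

(** Two arguments, since the row factors come from the [b] before a column step and the column
    factors from the one after it. *)
Definition scaled_plan b b' : 'M[R]_(m, n) :=
  \matrix_(i, j) (u 0 i / row_mass b i * K i j * expR (b' 0 j)).

Definition scaled_marginal b : 'rV[R]_n :=
  \row_j (v 0 j * expR (- b 0 j / gamma)).

Lemma row_mass_gt0 b i : 0 < row_mass b i.
Proof.
have [j Kij] := K_row i; rewrite /row_mass (bigD1 j)//= ltr_pwDl//.
  by rewrite mulr_gt0// expR_gt0.
by apply: sumr_ge0 => k _; rewrite mulr_ge0// expR_ge0.
Qed.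

Lemma row_scaling_gt0 b i : 0 < u 0 i / row_mass b i.
Proof. by rewrite divr_gt0// row_mass_gt0. Qed.

Lemma col_mass_gt0 b j : 0 < col_mass b j.
Proof.
have [i Kij] := K_col j; rewrite /col_mass (bigD1 i)//= ltr_pwDl//.
  by rewrite mulr_gt0// row_scaling_gt0.
by apply: sumr_ge0 => k _; rewrite mulr_ge0// ltW// row_scaling_gt0.
Qed.

Lemma row_mass_shift b b' d : (forall j, b 0 j <= b' 0 j + d) ->
  forall i, row_mass b i <= expR d * row_mass b' i.
Proof.
move=> bb' i; rewrite /row_mass mulr_sumr ler_sum// => k _.
by rewrite mulrCA ler_wpM2l// -expRD ler_expR addrC.
Qed.

(** Row masses stand in denominators, so [b] and [b'] change sides here; the minus sign in
    [log_sweep] turns them back. *)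
Lemma col_mass_shift b b' d : (forall j, b 0 j <= b' 0 j + d) ->
  forall j, col_mass b' j <= expR d * col_mass b j.
Proof.
move=> bb' j; rewrite /col_mass mulr_sumr ler_sum// => i _.
rewrite mulrA ler_wpM2r// mulrCA ler_pM2l//.
rewrite -[leLHS]mul1r ler_pdivrMr ?row_mass_gt0// mulrAC.
by rewrite ler_pdivlMr ?row_mass_gt0// mul1r row_mass_shift.
Qed.

Lemma log_sweep_shift b b' d : (forall j, b 0 j <= b' 0 j + d) ->
  forall j, log_sweep b 0 j <= log_sweep b' 0 j + gamma / (1 + gamma) * d.
Proof.
move=> bb' j; rewrite !mxE -mulrDr ler_wpM2l//.
  by rewrite divr_ge0// ?ltW// addr_gt0.
rewrite -addrA lerD2l lerNl opprD opprK lerBlDr addrC.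
rewrite -[X in X + _](expRK d) -lnM ?posrE ?expR_gt0 ?col_mass_gt0//.
by rewrite ler_ln ?posrE ?mulr_gt0 ?expR_gt0 ?col_mass_gt0// col_mass_shift.
Qed.

(** Each of [b], [b'] exceeds the other by at most the constant [|b - b'|], so [log_sweep_shift]
    applies in both directions. *)
Lemma log_sweep_lipschitz b b' :
  `|log_sweep b - log_sweep b'| <= gamma / (1 + gamma) * `|b - b'|.
Proof.
have q0 : 0 <= gamma / (1 + gamma) by rewrite divr_ge0// ?ltW// addr_gt0.
have le_shift (x y : 'rV[R]_n) j : x 0 j <= y 0 j + `|x - y|.
  rewrite -lerBlDl (le_trans (ler_norm _))//.
  by have /mx_norm_leP /(_ 0 j) := lexx `|x - y|; rewrite !mxE; apply.
apply/mx_norm_leP; first by rewrite mulr_ge0.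
move=> i j; rewrite (ord1 i) !mxE -/(_ - _) ler_distl.
have := log_sweep_shift (le_shift b b') j.
have := log_sweep_shift (le_shift b' b) j.
by rewrite distrC !mxE => h1 h2; apply/andP; split; lra.
Qed.

(* The column step multiplies [exp b_j] by [(v_j exp(- b_j / gamma - b_j) / c_j)]
   to the power [lambda = gamma / (1 + gamma)], with [c = col_mass b]; as
   [lambda * (1 + 1 / gamma) = 1], the previous [b_j] cancels. *)
Lemma scaling_stepE (a : 'I_m -> R) b : (forall i, 0 < a i) ->
  scaling_step u gamma
    (\matrix_(i, j) (a i * K i j * expR (b 0 j)), scaled_marginal b) =
  (scaled_plan b (log_sweep b), scaled_marginal (log_sweep b)).
Proof.
move=> a0; set T := \matrix_(i, j) _.
have rowT i : scaling_row u T i = u 0 i / row_mass b i / a i.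
  rewrite /scaling_row /row_sum -mulrA; congr (_ * _); rewrite -invfM.
  congr (_^-1); rewrite /row_mass mulr_suml; apply: eq_bigr => k _.
  by rewrite mxE; ring.
(* The row step renormalises each row, so the old factors [a] drop out and only [b] carries the
   state. *)
have rowTT i j : scaling_row u T i * T i j =
    u 0 i / row_mass b i * K i j * expR (b 0 j).
  rewrite rowT mxE; field; rewrite ?gt_eqF ?row_mass_gt0//.
have colT j : scaling_col u gamma T (scaled_marginal b) j =
    expR (log_sweep b 0 j - b 0 j).
  rewrite /scaling_col; under eq_bigr do rewrite rowTT.
  rewrite -mulr_suml -/(col_mass b j) mxE.
  have := col_mass_gt0 b j; set c := col_mass b j => c0.
  rewrite -[X in X `^ _]lnK ?posrE ?divr_gt0 ?mulr_gt0 ?expR_gt0//.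
  rewrite -expRM ln_div ?posrE ?mulr_gt0 ?expR_gt0//.
  rewrite !lnM ?posrE ?expR_gt0// !expRK; congr expR.
  rewrite mxE -/c; field.
  by rewrite !gt_eqF// addr_gt0.
congr pair; apply/matrixP => i j; rewrite [LHS]mxE [RHS]mxE.
  by rewrite rowTT colT -mulrA -expRD mxE; congr (_ * expR _); ring.
rewrite colT -expRM [X in _ * X]mxE mulrCA -expRD; congr (_ * expR _).
by field; rewrite gt_eqF.
Qed.

Definition log_seq (l : nat) : 'rV[R]_n := iter l log_sweep 0.

(** Stated from index 1 on: the row sums of [K] are arbitrary, so the initial plan need not be a
    [scaled_plan]. *)
Lemma scaling_seqE l : scaling_seq u gamma K v l.+1 =
  (scaled_plan (log_seq l) (log_seq l.+1), scaled_marginal (log_seq l.+1)).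
Proof.
elim: l => [|l IHl].
  (* The start [(K, v)] is the case [a = 1], [b = 0]. *)
  rewrite -(scaling_stepE (a := fun=> 1))//; congr (scaling_step _ _ (_, _)).
    by apply/matrixP => i j; rewrite !mxE expR0 mul1r mulr1.
  by apply/matrixP => i j; rewrite !mxE oppr0 mul0r expR0 mulr1 (ord1 i).
have -> : scaling_seq u gamma K v l.+2 =
    scaling_step u gamma (scaling_seq u gamma K v l.+1) by [].
rewrite IHl.
exact: (scaling_stepE (log_seq l.+1) (row_scaling_gt0 (log_seq l))).
Qed.

Lemma log_seq_cvg : exists2 b, log_sweep b = b & log_seq l @[l --> \oo] --> b.
Proof.
apply: (iter_contraction_cvg (q := gamma / (1 + gamma))).
- by rewrite divr_ge0// ?ltW// addr_gt0.
- by rewrite ltr_pdivrMr ?mul1r ?ltrDr// addr_gt0.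
- exact: log_sweep_lipschitz.
Qed.

Lemma scaling_seq_cvg b : log_seq l @[l --> \oo] --> b ->
  scaling_seq u gamma K v l @[l --> \oo] -->
    (scaled_plan b b, scaled_marginal b).
Proof.
move=> lb.
have lbS : log_seq l.+1 @[l --> \oo] --> b.
  by rewrite -(cvg_shiftS log_seq) in lb.
have entry (x : nat -> 'rV[R]_n) j : x l @[l --> \oo] --> b ->
    x l 0 j @[l --> \oo] --> b 0 j.
  move=> xb; apply: (cvg_comp x (fun b : 'rV[R]_n => b 0 j) xb).
  exact: coord_continuous.
have exp_cvg (x : nat -> R) y : x l @[l --> \oo] --> y ->
    expR (x l) @[l --> \oo] --> expR y.
  by move=> xy; apply: (cvg_comp x expR xy); exact: continuous_expR.
rewrite (_ : (fun l => _) = fun l => ((scaling_seq u gamma K v l).1,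
    (scaling_seq u gamma K v l).2)); last first.
  by apply/funext => l; rewrite -surjective_pairing.
apply: (cvg_pair (G := nbhs (scaled_plan b b)) (H := nbhs (scaled_marginal b)));
  apply: cvg_mx => i j.
  (* Dropping index 0 keeps the limit and makes [scaling_seqE] applicable. *)
  rewrite -(cvg_shiftS (fun l => (scaling_seq u gamma K v l).1 i j)).
  under eq_cvg => l do rewrite /mk_sequence scaling_seqE mxE.
  rewrite mxE; apply: cvgM; last exact/exp_cvg/entry.
  apply: cvgMl; apply: cvgMr; apply: cvgV; first by rewrite gt_eqF ?row_mass_gt0.
  apply: cvg_big => [|k _]; first exact: add_continuous.
  by apply: cvgMr; exact/exp_cvg/entry.
rewrite -(cvg_shiftS (fun l => (scaling_seq u gamma K v l).2 i j)).
under eq_cvg => l do rewrite /mk_sequence scaling_seqE mxE.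
by rewrite mxE; apply: cvgMr; apply: exp_cvg; apply: cvgMl; apply: cvgN;
  exact: entry.
Qed.

End LogSweep.

(** * Optimality and uniqueness of the fixed-point plan *)

Section Optimality.
Context {R : realType} {m n : nat}.
Variables (Z : {set 'I_m * 'I_n}) (u : 'rV[R]_m) (v : 'rV[R]_n) (gamma : R).
Variables (K : 'M[R]_(m, n)) (b : 'rV[R]_n).
Hypothesis u_gt0 : forall i, 0 < u 0 i.
Hypothesis v_gt0 : forall j, 0 < v 0 j.
Hypothesis gamma_gt0 : 0 < gamma.
Hypothesis Z_row : forall i, exists j, (i, j) \notin Z.
Hypothesis Z_col : forall j, exists i, (i, j) \notin Z.
Hypothesis K_gt0 : forall i j, (i, j) \notin Z -> 0 < K i j.
Hypothesis K_eq0 : forall i j, (i, j) \in Z -> K i j = 0.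
Hypothesis b_fixed : log_sweep u v gamma K b = b.

Let K_ge0 i j : 0 <= K i j.
Proof. by have [/K_eq0->//|/K_gt0/ltW] := boolP ((i, j) \in Z). Qed.

Let K_row i : exists j, 0 < K i j.
Proof. by have [j /K_gt0] := Z_row i; exists j. Qed.

Let K_col j : exists i, 0 < K i j.
Proof. by have [i /K_gt0] := Z_col j; exists i. Qed.

Let Tstar := scaled_plan u K b b.

Let Tstar_gt0 i j : (i, j) \notin Z -> 0 < Tstar i j.
Proof.
by move=> ijZ; rewrite mxE !mulr_gt0 ?expR_gt0 ?K_gt0 ?invr_gt0 ?row_mass_gt0.
Qed.

Let Tstar_eq0 i j : (i, j) \in Z -> Tstar i j = 0.
Proof. by move=> ijZ; rewrite mxE K_eq0// mulr0 mul0r. Qed.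

Lemma scaled_plan_row_plans : row_plans Z u Tstar.
Proof.
split; first by split=> i j => [/Tstar_gt0/ltW|/Tstar_eq0].
move=> i; rewrite /row_sum; under eq_bigr do rewrite mxE -mulrA.
by rewrite -mulr_sumr -/(row_mass K b i) divfK// gt_eqF// row_mass_gt0.
Qed.

(** With [c = col_mass], the fixed-point equation reads [(1 + 1 / gamma) b_j = ln v_j - ln c_j],
    that is [c_j exp b_j = v_j exp (- b_j / gamma)]. *)
Lemma scaled_plan_col_sums : col_sums Tstar = scaled_marginal v gamma b.
Proof.
apply/matrixP => i0 j; rewrite !mxE {i0}; under eq_bigr do rewrite mxE.
rewrite -mulr_suml -/(col_mass u K b j).
have c0 : 0 < col_mass u K b j by exact: col_mass_gt0.
have bj : b 0 j = gamma / (1 + gamma) * (ln (v 0 j) - ln (col_mass u K b j)).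
  by rewrite -[in LHS]b_fixed mxE.
rewrite -[X in X * _ = _]lnK ?posrE// -[X in _ = X * _]lnK ?posrE//.
rewrite -!expRD; congr expR; rewrite bj; field.
by rewrite !gt_eqF// addr_gt0.
Qed.

Lemma objective_decomposition T : row_plans Z u T ->
  objective Z K v gamma T = objective Z K v gamma Tstar +
    (KL_plan Z T Tstar + gamma * KL_vec (col_sums T) (col_sums Tstar)).
Proof.
move=> [[T_ge0 T_eq0] T_row].
have [_ Tstar_row] := scaled_plan_row_plans.
have w_ge0 j : 0 <= col_sums T 0 j.
  rewrite mxE sumr_ge0// => i _.
  by have [/T_eq0->//|/T_ge0] := boolP ((i, j) \in Z).
have wstar j : col_sums Tstar 0 j = v 0 j * expR (- b 0 j / gamma).
  by rewrite scaled_plan_col_sums mxE.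
pose a i := ln (u 0 i / row_mass K b i).
have plan_eq : KL_plan Z T K = KL_plan Z T Tstar + KL_plan Z Tstar K +
    \sum_(i < m) \sum_(j < n) (T i j - Tstar i j) * (a i + b 0 j).
  (* Both plans vanish on [Z], so the cross term may run over the full rectangle, where rows and
     columns can be summed separately. *)
  rewrite pair_big/= (bigID (mem Z))/= [X in _ + (X + _)]big1 ?add0r; last first.
    by move=> [i j] /= ijZ; rewrite T_eq0// Tstar_eq0// subrr mul0r.
  rewrite /KL_plan -!big_split/=; apply: eq_bigr => -[i j] /= ijZ.
  rewrite (kl_three_points (T_ge0 _ _ ijZ) (Tstar_gt0 ijZ) (K_gt0 ijZ)).
  congr (_ + _ * _).
  rewrite mxE mulrAC mulfK ?gt_eqF ?K_gt0//.
  by rewrite lnM ?posrE ?expR_gt0 ?divr_gt0 ?row_mass_gt0// expRK.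
(* Here [gamma * ln (y_j / v_j) = - b_j] for the column sums [y] of [Tstar], which yields the
   opposite of the [b] part of the plan's cross term. *)
have vec_eq : gamma * KL_vec (col_sums T) v =
    gamma * KL_vec (col_sums T) (col_sums Tstar) +
    gamma * KL_vec (col_sums Tstar) v -
    \sum_(j < n) (col_sums T 0 j - col_sums Tstar 0 j) * b 0 j.
  rewrite /KL_vec -mulrDr -big_split/= !mulr_sumr -sumrB; apply: eq_bigr => j _.
  have wstar_gt0 : 0 < col_sums Tstar 0 j by rewrite wstar mulr_gt0 ?expR_gt0.
  rewrite (kl_three_points (w_ge0 j) wstar_gt0 (v_gt0 j)).
  rewrite [X in ln (X / _)]wstar [_ * expR _]mulrC mulfK ?gt_eqF// expRK.
  by field; rewrite gt_eqF.
(* The [a] part vanishes because [T] and [Tstar] have the same row sums. *)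
have cross : \sum_(i < m) \sum_(j < n) (T i j - Tstar i j) * (a i + b 0 j) =
    \sum_(j < n) (col_sums T 0 j - col_sums Tstar 0 j) * b 0 j.
  under eq_bigr do (under eq_bigr do rewrite mulrDr; rewrite big_split/=).
  rewrite big_split/= big1 ?add0r => [|i _].
    rewrite exchange_big/=; apply: eq_bigr => j _.
    by rewrite !mxE -sumrB mulr_suml.
  by rewrite -mulr_suml sumrB -/(row_sum T i) -/(row_sum Tstar i)
    T_row Tstar_row subrr mul0r.
by rewrite /objective plan_eq vec_eq cross; ring.
Qed.

Lemma scaled_plan_minimizer :
  unique (minimizer (row_plans Z u) (objective Z K v gamma)) Tstar.
Proof.
have plan_term_ge0 T : row_plans Z u T -> forall p, p \notin Z ->
    0 <= kl (T p.1 p.2) (Tstar p.1 p.2).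
  move=> [[T_ge0 _] _] [i j] /= ijZ.
  exact: kl_ge0 (T_ge0 _ _ ijZ) (Tstar_gt0 ijZ).
have gap_ge0 T : row_plans Z u T ->
    0 <= gamma * KL_vec (col_sums T) (col_sums Tstar).
  move=> [[T_ge0 T_eq0] _]; rewrite pmulr_rge0// sumr_ge0// => j _.
  apply: kl_ge0; last by rewrite scaled_plan_col_sums mxE mulr_gt0 ?expR_gt0.
  rewrite mxE sumr_ge0// => i _.
  by have [/T_eq0->//|/T_ge0] := boolP ((i, j) \in Z).
have KL_plan_ge0 T : row_plans Z u T -> 0 <= KL_plan Z T Tstar.
  by move=> uT; apply: sumr_ge0; exact: plan_term_ge0.
split=> [|T [uT /(_ _ scaled_plan_row_plans)]].
  split; first exact: scaled_plan_row_plans.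
  by move=> T uT; rewrite (objective_decomposition uT) lerDl
    addr_ge0 ?gap_ge0 ?KL_plan_ge0.
(* For another minimizer the two nonnegative gap terms add up to at most 0; a zero plan term forces
   equality with [Tstar] entry by entry off [Z]. *)
rewrite (objective_decomposition uT) gerDl => gap_le0.
have KL0 : KL_plan Z T Tstar = 0.
  by have := gap_ge0 T uT; have := KL_plan_ge0 T uT; lra.
apply/matrixP => i j; have [[T_ge0 T_eq0] _] := uT.
have [ijZ|ijZ] := boolP ((i, j) \in Z); first by rewrite T_eq0// Tstar_eq0.
apply/esym/kl_eq0; [exact: T_ge0|exact: Tstar_gt0|].
exact: (psumr_eq0P (plan_term_ge0 T uT) KL0 (i := (i, j))).
Qed.

End Optimality.

(** * Convergence and optimality combined *)

Theorem theorem1 (R : realType) (m n : nat) (u : 'rV[R]_m) (v : 'rV[R]_n)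
    (Z : {set 'I_m * 'I_n}) (gamma gamma0 : R) (c Ttilde : 'M[R]_(m, n))
    (m_gt0 : (0 < m)%N) (n_gt0 : (0 < n)%N)
    (u_gt0 : forall i, 0 < u 0 i) (v_gt0 : forall j, 0 < v 0 j)
    (Z_row : forall i, exists j, (i, j) \notin Z)
    (Z_col : forall j, exists i, (i, j) \notin Z)
    (gamma_gt0 : 0 < gamma) (gamma0_gt0 : 0 < gamma0)
    (Ttilde_plan : plans Z Ttilde)
    (Ttilde_gt0 : forall i j, (i, j) \notin Z -> 0 < Ttilde i j) :
  let K := ref_kernel Z gamma0 c Ttilde in
  exists (Tstar : 'M[R]_(m, n)) (vstar : 'rV[R]_n),
    unique (fun Tv : 'M[R]_(m, n) * 'rV[R]_n =>
              scaling_seq u gamma K v l @[l --> \oo] --> Tv) (Tstar, vstar) /\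
    unique (minimizer (row_plans Z u) (objective Z K v gamma)) Tstar.

Proof.
move=> K.
have K_gt0 i j : (i, j) \notin Z -> 0 < K i j.
  by move=> ijZ; rewrite mxE (negPf ijZ) mulr_gt0 ?expR_gt0 ?Ttilde_gt0.
have K_eq0 i j : (i, j) \in Z -> K i j = 0 by move=> ijZ; rewrite mxE ijZ.
have K_ge0 i j : 0 <= K i j.
  by have [/K_eq0->//|/K_gt0/ltW] := boolP ((i, j) \in Z).
have K_row i : exists j, 0 < K i j by have [j /K_gt0] := Z_row i; exists j.
have K_col j : exists i, 0 < K i j by have [i /K_gt0] := Z_col j; exists i.
have [b b_fixed b_cvg] := log_seq_cvg v u_gt0 gamma_gt0 K_ge0 K_row K_col.
have seq_cvg := scaling_seq_cvg u_gt0 v_gt0 gamma_gt0 K_ge0 K_row K_col b_cvg.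
exists (scaled_plan u K b b), (scaled_marginal v gamma b); split.
  by split=> // Tv; apply: cvg_unique seq_cvg; exact: norm_hausdorff.
exact: scaled_plan_minimizer.
Qed.
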